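(* Let $U\subseteq\mathbb H$ be an axially symmetric open set, let $f$ be a left slice hyperholomorphic function on $U$, and let $p\in U$. Assume that $f$ admits the $*$-Taylor expansion $$f(q)=\sum_{n=0}^\infty(q-p)^{*n}a_n,\qquad a_n\in\mathbb H,$$ convergent absolutely and uniformly on the compact subsets of a nonempty $\Omega(p,R)\subset U$, where $\frac1R=\limsup_{n\to\infty}|a_n|^{1/n}$, $R>0$. Then $$\Delta f(q)=\sum_{n=0}^\infty\widetilde Q_n(q,p)\,b_n,\qquad q\in\Omega(p,R),\qquad b_n:=-2(n+2)(n+1)a_{n+2}.$$
   Context: $\mathbb H$ denotes the quaternions $q=q_0+q_1e_1+q_2e_2+q_3e_3$ with the usual relations, $\underline q=q_1e_1+q_2e_2+q_3e_3$, $\bar q=q_0-\underline q$, $\mathbb S=\{\underline q:|\underline q|=1\}$, $\mathbb C_I=\mathbb R+I\mathbb R$ for $I\in\mathbb S$, $[q]=\{q_0+I|\underline q|:I\in\mathbb S\}$; a set $U$ is axially symmetric if $[q]\subset U$ for all $q\in U$. Slice hyperholomorphic: for $U$ axially symmetric open and $\mathcal U=\{(u,v)\in\mathbb R^2:u+\mathbb Sv\subset U\}$, $f:U\to\mathbb H$ is left slice hyperholomorphic if $f(u+Iv)=\alpha(u,v)+I\beta(u,v)$ for all $(u,v)\in\mathcal U$, $I\in\mathbb S$, with $C^1$ functions $\alpha,\beta:\mathcal U\to\mathbb H$, $\alpha$ even and $\beta$ odd in $v$, satisfying $\partial_u\alpha=\partial_v\beta$, $\partial_v\alpha=-\partial_u\beta$.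 $\Delta=\sum_{i=0}^3\partial_{q_i}^2$ in the variable $q$. $\Omega(p,R)$: choose $I\in\mathbb S$ with $p\in\mathbb C_I$ and let $D_I(p,R)=\{z\in\mathbb C_I:|z-p|<R\}$; then $\Omega(p,R)=\{x+Jy:J\in\mathbb S,\ x,y\in\mathbb R,\ x+yI\in D_I(p,R)\text{ and }x-yI\in D_I(p,R)\}$. $*$-powers and products (left $*$-product in $q$): $(q-p)^{*m}=\sum_{i=0}^m\binom mi q^i(-p)^{m-i}$, $(\bar q-p)^{*k}=\sum_{j=0}^k\binom kj\bar q^j(-p)^{k-j}$, $(q-p)^{*m}*(\bar q-p)^{*k}=\sum_{i=0}^m\sum_{j=0}^k\binom mi\binom kj q^i\bar q^j(-p)^{m-i+k-j}$. $$\widetilde Q_n(q,p)=2\sum_{j=0}^n\frac{n-j+1}{(n+1)(n+2)}(q-p)^{*(n-j)}*(\bar q-p)^{*j},\quad n\ge0.$$ *)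

(* Defs.v *)
From HB Require Import structures.
From mathcomp Require Import all_boot all_order all_algebra.
From mathcomp Require Import ring.
From mathcomp Require Import all_classical all_reals all_analysis.

Set Implicit Arguments.
Unset Strict Implicit.
Unset Printing Implicit Defensive.

Import Order.TTheory GRing.Theory Num.Theory.
Import numFieldNormedType.Exports.

Local Open Scope classical_set_scope.
Local Open Scope ring_scope.

(* The quaternion q_0 + q_1 e_1 + q_2 e_2 + q_3 e_3 is the row vector of its
   real coordinates. The type inherits the topology and real normed-space
   structure of 'rV[R]_4; in particular the library norm on it is the sup norm.
   The Euclidean modulus is [qabs] below. *)
Definition quat (R : realType) : Type := 'rV[R]_4.

HB.instance Definition _ (R : realType) := NormedModule.copy (quat R) 'rV[R]_4.
HB.instance Definition _ (R : realType) := Complete.copy (quat R) 'rV[R]_4.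

Section Quaternions.
Variable R : realType.
Implicit Types (p q r : quat R) (x y : R).

Definition qcoord (i : 'I_4) q : R := (q : 'rV[R]_4) ord0 i.

Definition mkquat x0 x1 x2 x3 : quat R :=
  (\row_(i < 4) [:: x0; x1; x2; x3]`_i : 'rV[R]_4).

Definition qbasis (i : 'I_4) : quat R := (delta_mx ord0 i : 'rV[R]_4).

Local Notation q_0 := (qcoord (inord 0)).
Local Notation q_1 := (qcoord (inord 1)).
Local Notation q_2 := (qcoord (inord 2)).
Local Notation q_3 := (qcoord (inord 3)).

Lemma qcoord_mkquat x0 x1 x2 x3 (i : 'I_4) :
  qcoord i (mkquat x0 x1 x2 x3) = [:: x0; x1; x2; x3]`_i.
Proof. by rewrite /qcoord mxE. Qed.

Lemma quatP p q :
  q_0 p = q_0 q -> q_1 p = q_1 q -> q_2 p = q_2 q -> q_3 p = q_3 q -> p = q.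
Proof.
move=> h0 h1 h2 h3; apply/rowP => i; rewrite -[i]inord_val.
by case: i => -[|[|[|[|//]]]] /= _.
Qed.

Lemma qcoordD i p q : qcoord i (p + q) = qcoord i p + qcoord i q.
Proof. by rewrite /qcoord mxE. Qed.

Lemma qcoordZ i x q : qcoord i (x *: q) = x * qcoord i q.
Proof. by rewrite /qcoord mxE. Qed.

Definition qone : quat R := mkquat 1 0 0 0.

Definition qmul p q : quat R := mkquat
  (q_0 p * q_0 q - q_1 p * q_1 q - q_2 p * q_2 q - q_3 p * q_3 q)
  (q_0 p * q_1 q + q_1 p * q_0 q + q_2 p * q_3 q - q_3 p * q_2 q)
  (q_0 p * q_2 q - q_1 p * q_3 q + q_2 p * q_0 q + q_3 p * q_1 q)
  (q_0 p * q_3 q + q_1 p * q_2 q - q_2 p * q_1 q + q_3 p * q_0 q).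

Let qE := (qcoordD, qcoordZ, qcoord_mkquat, inordK).

Lemma qmulA : associative qmul.
Proof. by move=> p q r; apply: quatP; rewrite !qE //=; ring. Qed.

Lemma qmul1l : left_id qone qmul.
Proof. by move=> q; apply: quatP; rewrite !qE //=; ring. Qed.

Lemma qmul1r : right_id qone qmul.
Proof. by move=> q; apply: quatP; rewrite !qE //=; ring. Qed.

Lemma qmulDl : left_distributive qmul +%R.
Proof. by move=> p q r; apply: quatP; rewrite !qE //=; ring. Qed.

Lemma qmulDr : right_distributive qmul +%R.
Proof. by move=> p q r; apply: quatP; rewrite !qE //=; ring. Qed.

Lemma qone_neq0 : qone != 0.
Proof.
apply/eqP => /(congr1 q_0); rewrite qcoord_mkquat inordK //= /qcoord mxE.
by move/eqP; rewrite oner_eq0.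
Qed.

Lemma qscaleAl x p q : x *: qmul p q = qmul (x *: p) q.
Proof. by apply: quatP; rewrite !qE //=; ring. Qed.

Lemma qscaleAr x p q : x *: qmul p q = qmul p (x *: q).
Proof. by apply: quatP; rewrite !qE //=; ring. Qed.

HB.instance Definition _ := GRing.Zmodule_isNzRing.Build (quat R)
  qmulA qmul1l qmul1r qmulDl qmulDr qone_neq0.
HB.instance Definition _ := GRing.Lmodule_isLalgebra.Build R (quat R) qscaleAl.
HB.instance Definition _ := GRing.Lalgebra_isAlgebra.Build R (quat R) qscaleAr.

Definition qre q : R := q_0 q.
Definition qim q : quat R := q - (qre q)%:A.
Definition qconj q : quat R := (qre q)%:A - qim q.
Definition qabs q : R := Num.sqrt (\sum_(i < 4) qcoord i q ^+ 2).

Definition qsphere : set (quat R) := [set q | qre q = 0 /\ qabs q = 1].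

Definition slice_plane (I : quat R) : set (quat R) :=
  [set z | exists x y : R, z = x%:A + y *: I].

Definition qclass q : set (quat R) :=
  [set r | exists2 I, qsphere I & r = (qre q)%:A + qabs (qim q) *: I].

Definition axially_symmetric (U : set (quat R)) : Prop :=
  forall q, U q -> qclass q `<=` U.

Definition slice_coords (U : set (quat R)) : set (R * R) :=
  [set w | forall I, qsphere I -> U (w.1%:A + w.2 *: I)].

Definition pd_u (g : R * R -> quat R) : R * R -> quat R := 'D_(1, 0) g.
Definition pd_v (g : R * R -> quat R) : R * R -> quat R := 'D_(0, 1) g.

Definition C1_on (W : set (R * R)) (g : R * R -> quat R) : Prop :=
  forall w, W w ->
    [/\ derivable g w (1, 0), derivable g w (0, 1),
        {for w, continuous (pd_u g)} & {for w, continuous (pd_v g)}].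

(* Functions on U are represented by total functions of which only the values
   on U matter; likewise for alpha and beta on [slice_coords U], which is open
   when U is open and axially symmetric. *)
Definition slice_hyperholomorphic (U : set (quat R)) (f : quat R -> quat R) :
    Prop :=
  exists alpha beta : R * R -> quat R,
    [/\ C1_on (slice_coords U) alpha,
        C1_on (slice_coords U) beta,
        (forall u v, slice_coords U (u, v) ->
           alpha (u, - v) = alpha (u, v) /\ beta (u, - v) = - beta (u, v)),
        (forall w, slice_coords U w ->
           pd_u alpha w = pd_v beta w /\ pd_v alpha w = - pd_u beta w) &
        (forall u v I, slice_coords U (u, v) -> qsphere I ->
           f (u%:A + v *: I) = alpha (u, v) + I * beta (u, v))].

(* The sum of the second partial derivatives is meaningful as a Laplacian only
   where these exist; the library's derivative ['D_v f] is a total operator. *)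
Definition has_second_partials (f : quat R -> quat R) q : Prop :=
  forall i : 'I_4,
    (\forall x \near q, derivable f x (qbasis i)) /\
    derivable ('D_(qbasis i) f) q (qbasis i).

Definition laplacian (f : quat R -> quat R) q : quat R :=
  \sum_(i < 4) 'D_(qbasis i) ('D_(qbasis i) f) q.

(* D_I(p, rho); the radius may be infinite. *)
Definition slice_disc (I p : quat R) (rho : \bar R) : set (quat R) :=
  [set z | slice_plane I z /\ ((qabs (z - p))%:E < rho)%E].

(* Omega(p, rho), computed from the choice of an I such that p is in C_I. *)
Definition Omega (I p : quat R) (rho : \bar R) : set (quat R) :=
  [set q | exists x y J,
     [/\ qsphere J, slice_disc I p rho (x%:A + y *: I),
         slice_disc I p rho (x%:A - y *: I) & q = x%:A + y *: J]].

Definition star_pow (m : nat) (q p : quat R) : quat R :=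
  \sum_(0 <= i < m.+1) q ^+ i * (- p) ^+ (m - i) *+ 'C(m, i).

Definition star_pow_mul (m k : nat) (q p : quat R) : quat R :=
  \sum_(0 <= i < m.+1) \sum_(0 <= j < k.+1)
    q ^+ i * qconj q ^+ j * (- p) ^+ (m - i + (k - j)) *+ ('C(m, i) * 'C(k, j)).

Definition Qtilde (n : nat) (q p : quat R) : quat R :=
  2 * \sum_(0 <= j < n.+1)
    (((n - j).+1%:R / (n.+1%:R * n.+2%:R)) : R) *: star_pow_mul (n - j) j q p.

End Quaternions.

Arguments qsphere {R}.

(* Main.v *)
Require Import Defs.
From HB Require Import structures.
From mathcomp Require Import all_boot all_order all_algebra.
From mathcomp Require Import all_classical all_reals all_analysis.
From mathcomp Require Import ring lra.

Set Implicit Arguments.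
Unset Strict Implicit.
Unset Printing Implicit Defensive.

Import Order.TTheory GRing.Theory Num.Theory.
Import numFieldNormedType.Exports.

Local Open Scope classical_set_scope.
Local Open Scope ring_scope.

(* Let T = L_q - R_p be the real-linear operator h |-> q h - h p. Since left and
   right multiplications commute, (q - p)^{*n} = T^n 1, and similarly
   (q - p)^{*m} * (conj q - p)^{*k} = T^m S^k 1 with S = L_{conj q} - R_p, so
   every star product becomes a composition of commuting operators. The
   Euclidean operator norm of T is at most
   r(q) = sqrt ((q_0 - p_0)^2 + (|im q| + |im p|)^2), and Omega(p, rho) is
   exactly {r < rho}, so f is an ordinary power series in T inside its disc of
   convergence; along q + t e the operator moves by t L_e, and the partial sums
   can be differentiated twice term by term with remainders O(t^2).
   Finally, summing over the basis, e_i x e_i adds up to -2 conj x, whence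
   the sum over i of L_{e_i} T^k L_{e_i} is -2 S^k, which turns the Laplacian
   of T^(n+2) 1 into -4 times the sum over j <= n of
   (n - j + 1) T^(n-j) S^j 1. *)

(** * Euclidean modulus of quaternions and the shape of [Omega] *)

Section QuaternionModulus.
Variable R : realType.
Implicit Types (p q h I : quat R) (x y : R).

Local Notation q_0 := (@qcoord R (inord 0)).
Local Notation q_1 := (@qcoord R (inord 1)).
Local Notation q_2 := (@qcoord R (inord 2)).
Local Notation q_3 := (@qcoord R (inord 3)).

Lemma big_ord4 (V : nmodType) (F : 'I_4 -> V) :
  \sum_(i < 4) F i = F (inord 0) + F (inord 1) + F (inord 2) + F (inord 3).
Proof.
rewrite !big_ord_recl big_ord0 addr0 !addrA.
by congr (F _ + F _ + F _ + F _); apply/val_inj; rewrite /= inordK.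
Qed.

Lemma qcoordN i q : qcoord i (- q) = - qcoord i q.
Proof. by rewrite /qcoord mxE. Qed.

Lemma qcoord1 i : qcoord i (1 : quat R) = [:: 1; 0; 0; 0]`_i.
Proof. exact: qcoord_mkquat. Qed.

Lemma qcoordM0 p q : q_0 (p * q) =
  q_0 p * q_0 q - q_1 p * q_1 q - q_2 p * q_2 q - q_3 p * q_3 q.
Proof. by rewrite qcoord_mkquat inordK. Qed.

Lemma qcoordM1 p q : q_1 (p * q) =
  q_0 p * q_1 q + q_1 p * q_0 q + q_2 p * q_3 q - q_3 p * q_2 q.
Proof. by rewrite qcoord_mkquat inordK. Qed.

Lemma qcoordM2 p q : q_2 (p * q) =
  q_0 p * q_2 q - q_1 p * q_3 q + q_2 p * q_0 q + q_3 p * q_1 q.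
Proof. by rewrite qcoord_mkquat inordK. Qed.

Lemma qcoordM3 p q : q_3 (p * q) =
  q_0 p * q_3 q + q_1 p * q_2 q - q_2 p * q_1 q + q_3 p * q_0 q.
Proof. by rewrite qcoord_mkquat inordK. Qed.

Lemma qcoord_basis i j : qcoord i (qbasis R j) = (i == j)%:R.
Proof. by rewrite /qcoord /qbasis mxE eqxx. Qed.

Lemma qcoord_qim i q : qcoord i (qim q) = [:: 0; q_1 q; q_2 q; q_3 q]`_i.
Proof.
rewrite /qim /qre qcoordD qcoordN qcoordZ qcoord1 -[i]inord_val.
by case: i => -[|[|[|[|//]]]] /= _; rewrite !inordK //=; ring.
Qed.

Lemma qcoord_qconj i q :
  qcoord i (qconj q) = [:: q_0 q; - q_1 q; - q_2 q; - q_3 q]`_i.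
Proof.
rewrite /qconj /qre qcoordD qcoordN qcoordZ qcoord1 qcoord_qim -[i]inord_val.
by case: i => -[|[|[|[|//]]]] /= _; rewrite !inordK //=; ring.
Qed.

Definition qcoordE := (qcoord_qim, qcoord_qconj, qcoordD, qcoordN, qcoordZ,
  qcoord_mkquat, qcoord1, qcoordM0, qcoordM1, qcoordM2, qcoordM3, qcoord_basis,
  inordK).

Lemma qabs_ge0 q : 0 <= qabs q.
Proof. exact: sqrtr_ge0. Qed.
Local Hint Resolve qabs_ge0 : core.

Lemma qabs_sqr q :
  qabs q ^+ 2 = q_0 q ^+ 2 + q_1 q ^+ 2 + q_2 q ^+ 2 + q_3 q ^+ 2.
Proof.
rewrite sqr_sqrtr; first by rewrite big_ord4.
by rewrite sumr_ge0 // => i _; exact: sqr_ge0.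
Qed.

Lemma eq_qabs p q : qabs p ^+ 2 = qabs q ^+ 2 -> qabs p = qabs q.
Proof. by apply: pexpIrn; rewrite ?nnegrE. Qed.

Lemma qabsM p q : qabs (p * q) = qabs p * qabs q.
Proof.
apply: (@pexpIrn _ 2); rewrite ?nnegrE ?mulr_ge0// exprMn.
by rewrite !qabs_sqr !qcoordE //=; ring.
Qed.

Lemma qabsZ x q : qabs (x *: q) = `|x| * qabs q.
Proof.
apply: (@pexpIrn _ 2); rewrite ?nnegrE ?mulr_ge0// exprMn.
rewrite real_normK ?num_real//.
by rewrite !qabs_sqr !qcoordE //=; ring.
Qed.

Lemma qabsN q : qabs (- q) = qabs q.
Proof. by rewrite -scaleN1r qabsZ normrN normr1 mul1r. Qed.

Lemma qabs0 : qabs (0 : quat R) = 0.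
Proof. by rewrite -(scale0r (0 : quat R)) qabsZ normr0 mul0r. Qed.

Lemma qabs_eq0 q : qabs q = 0 -> q = 0.
Proof.
move=> /(congr1 (fun x => x ^+ 2)); rewrite qabs_sqr expr0n /= => h.
have s i : 0 <= qcoord i q ^+ 2 by exact: sqr_ge0.
have z i : qcoord i q ^+ 2 = 0 -> qcoord i q = qcoord i (0 : quat R).
  by move/eqP; rewrite sqrf_eq0 [RHS]mxE => /eqP.
move: (s (inord 0)) (s (inord 1)) (s (inord 2)) (s (inord 3)) => s0 s1 s2 s3.
by apply: quatP; apply: z; lra.
Qed.

Lemma qabs1 : qabs (1 : quat R) = 1.
Proof.
apply: (@pexpIrn _ 2); rewrite ?nnegrE//.
by rewrite !qabs_sqr !qcoordE //=; ring.
Qed.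

Lemma qabs_basis i : qabs (qbasis R i) = 1.
Proof.
rewrite /qabs (bigD1 i) //= big1 => [|j ji].
  by rewrite qcoord_basis eqxx expr1n addr0 sqrtr1.
by rewrite qcoord_basis (negbTE ji) expr0n.
Qed.

Lemma qcoord_le_qabs i q : `|qcoord i q| <= qabs q.
Proof.
rewrite -sqrtr_sqr ler_wsqrtr //.
by rewrite (bigD1 i) //= lerDl sumr_ge0 // => j _; exact: sqr_ge0.
Qed.

Lemma qabs_conj q : qabs (qconj q) = qabs q.
Proof.
by apply: eq_qabs; rewrite !qabs_sqr /qre !qcoordE //=; ring.
Qed.

Lemma qabsD p q : qabs (p + q) <= qabs p + qabs q.
Proof.
rewrite -(@ler_pXn2r _ 2) ?nnegrE ?addr_ge0//.
have -> : qabs (p + q) ^+ 2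
    = qabs p ^+ 2 + qre (p * qconj q) *+ 2 + qabs q ^+ 2.
  by rewrite !qabs_sqr /qre !qcoordE //=; ring.
rewrite sqrrD lerD2r lerD2l lerMn2r /= (le_trans (ler_norm _))//.
by rewrite (le_trans (qcoord_le_qabs _ _))// qabsM qabs_conj.
Qed.

Lemma qabsB p q : qabs (p - q) <= qabs p + qabs q.
Proof. by rewrite -(qabsN q) qabsD. Qed.

Lemma qabs_dist p q : `|qabs p - qabs q| <= qabs (p - q).
Proof.
have := qabsD (p - q) q; have := qabsD (q - p) p.
rewrite !subrK -(qabsN (q - p)) opprB => h1 h2.
by rewrite ler_norml; apply/andP; split; lra.
Qed.

(** Limits and derivatives are taken in the sup norm, while every estimate is made with the
    multiplicative [qabs]. This bound and [qabs_le_norm] pass between the two; the factor 2 there is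
    the square root of the dimension 4. *)
Lemma norm_le_qabs q : `|q| <= qabs q.
Proof.
rewrite (_ : `|q| = mx_norm (q : 'rV[R]_4)) //.
rewrite mx_normrE bigmax_le // => -[i j] _ /=.
by rewrite ord1; exact: qcoord_le_qabs.
Qed.

Lemma qabs_le_norm q : qabs q <= 2 * `|q|.
Proof.
rewrite -(@ler_pXn2r _ 2) ?nnegrE ?mulr_ge0 ?normr_ge0 // qabs_sqr exprMn.
have c i : qcoord i q ^+ 2 <= `|q| ^+ 2.
  rewrite -real_normK ?num_real // lerXn2r ?nnegrE ?normr_ge0 //.
  by rewrite (_ : `|q| = mx_norm (q : 'rV[R]_4)) // mx_normrE;
    exact: (@le_bigmax _ _ _ _ (fun ij => `|q ij.1 ij.2|) (ord0, i)).
by move: (c (inord 0)) (c (inord 1)) (c (inord 2)) (c (inord 3)); lra.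
Qed.

(* The larger of the two distances from p to the points q_0 +- I |im q|, where
   p lies in C_I. *)
Definition qradius p q : R :=
  qabs (mkquat (qre q - qre p) (qabs (qim q) + qabs (qim p)) 0 0).

Lemma qradius_sqr p q : qradius p q ^+ 2 =
  (qre q - qre p) ^+ 2 + (qabs (qim q) + qabs (qim p)) ^+ 2.
Proof. by rewrite qabs_sqr !qcoordE //=; ring. Qed.

(** [qradius p q] is the length of a plane vector. Replacing q by r moves that vector by the
    differences of the real parts and of the moduli of the imaginary parts, and the latter is
    controlled by the reverse triangle inequality. *)
Lemma qradius_lip p q r : qradius p r <= qradius p q + qabs (r - q).
Proof.
set w := mkquat (qre r - qre q) (qabs (qim r) - qabs (qim q)) 0 0.
have -> : qradius p r = qabs
    (mkquat (qre q - qre p) (qabs (qim q) + qabs (qim p)) 0 0 + w).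
  by congr qabs; apply: quatP; rewrite /w !qcoordE //=; ring.
rewrite (le_trans (qabsD _ _))// lerD2l.
rewrite -(@ler_pXn2r _ 2) ?nnegrE//.
have -> : qabs (r - q) ^+ 2 = (qre r - qre q) ^+ 2 + qabs (qim r - qim q) ^+ 2.
  by rewrite !qabs_sqr /qre !qcoordE //=; ring.
rewrite [leLHS](_ : _ = (qre r - qre q) ^+ 2 +
    (qabs (qim r) - qabs (qim q)) ^+ 2); last first.
  by rewrite qabs_sqr /w !qcoordE //=; ring.
rewrite lerD2l.
by rewrite -[leLHS]real_normK ?num_real // lerXn2r ?nnegrE// qabs_dist.
Qed.

(** The real parts contribute a real multiple of h, and [qim q * h - h * qim p] is orthogonal to h,
    so Pythagoras applies. The triangle inequality then bounds the second component. *)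
Lemma qabs_comm_le p q h : qabs (q * h - h * p) <= qradius p q * qabs h.
Proof.
rewrite -(@ler_pXn2r _ 2) ?nnegrE ?mulr_ge0 ?qabs_ge0// exprMn.
rewrite qradius_sqr mulrDl.
have -> : qabs (q * h - h * p) ^+ 2 = (qre q - qre p) ^+ 2 * qabs h ^+ 2 +
    qabs (qim q * h - h * qim p) ^+ 2.
  by rewrite !qabs_sqr /qre !qcoordE //=; ring.
rewrite lerD2l -exprMn lerXn2r ?nnegrE ?mulr_ge0 ?addr_ge0//.
by rewrite (le_trans (qabsB _ _))// !qabsM mulrDl [qabs h * _]mulrC.
Qed.

Lemma qabs_slice I x y : qsphere I ->
  qabs (x%:A + y *: I) ^+ 2 = x ^+ 2 + y ^+ 2.
Proof.
move=> [I0 I1]; have := congr1 (fun x => x ^+ 2) I1.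
rewrite /= !qabs_sqr !qcoordE //=; move: I0; rewrite /qre => ->.
by move=> I1'; transitivity (x ^+ 2 + y ^+ 2 *
  (0 ^+ 2 + q_1 I ^+ 2 + q_2 I ^+ 2 + q_3 I ^+ 2));
  [ring | rewrite I1'; ring].
Qed.

Lemma qre_slice I x y : qsphere I -> qre (x%:A + y *: I) = x.
Proof. by move=> [I0 _]; move: I0; rewrite /qre !qcoordE //= => ->; ring. Qed.

Lemma qim_slice I x y : qsphere I -> qim (x%:A + y *: I) = y *: I.
Proof. by move=> SI; rewrite /qim qre_slice // addrC addKr. Qed.

(** Both points x + yI and x - yI have to lie in the disc, so only the farther one counts, and its
    distance to p is [qradius p q]. *)
Lemma Omega_qradius I p q rho : qsphere I -> slice_plane I p ->
  Omega I p rho q <-> ((qradius p q)%:E < rho)%E.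
Proof.
move=> SI [a [b ->]] {p}.
have dist x y :
    qabs (x%:A + y *: I - (a%:A + b *: I)) ^+ 2 = (x - a) ^+ 2 + (y - b) ^+ 2.
  by rewrite -(qabs_slice _ _ SI) opprD addrACA -!scalerBl.
have abs J y : qsphere J -> qabs (y *: J) = `|y|.
  by case=> _ J1; rewrite qabsZ J1 mulr1.
split=> [[x [y [J [SJ [_ d1] [_ d2] ->]]]]|lt_rho].
  have r2 := qradius_sqr (a%:A + b *: I) (x%:A + y *: J).
  rewrite !qre_slice // !qim_slice // !abs // in r2.
  (* With p = a + bI, the farther of the two points is the one whose I-coordinate has sign opposite
     to b, hence the case split on the sign of y * b. *)
  have : qradius (a%:A + b *: I) (x%:A + y *: J)
      = qabs (x%:A + y *: I - (a%:A + b *: I)) \/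
    qradius (a%:A + b *: I) (x%:A + y *: J)
      = qabs (x%:A - y *: I - (a%:A + b *: I)).
    have [le0|gt0] := lerP 0 (y * b); [right|left]; apply: eq_qabs;
      rewrite r2 -?scaleNr dist; congr (_ + _);
      rewrite !(sqrrD, sqrrN) !real_normK ?num_real // -normrM.
      by rewrite ger0_norm //; ring.
    by rewrite ltr0_norm //; ring.
  by case=> ->.
have le_r y : `|y| = qabs (qim q) ->
    ((qabs ((qre q)%:A + y *: I - (a%:A + b *: I)))%:E < rho)%E.
  move=> ay; apply: le_lt_trans lt_rho; rewrite lee_fin.
  rewrite -(@ler_pXn2r _ 2) ?nnegrE ?qabs_ge0// (dist (qre q) y) qradius_sqr.
  rewrite !qre_slice // !qim_slice // !abs // lerD2l -ay.
  rewrite -[leLHS]real_normK ?num_real // lerXn2r ?nnegrE ?addr_ge0//.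
  exact: ler_normB.
(* A real q lies in every slice, so I itself serves; otherwise J is the normalized imaginary
   part. *)
have [J SJ qJ] : exists2 J, qsphere J & q = (qre q)%:A + qabs (qim q) *: J.
  have [im0|im0] := eqVneq (qabs (qim q)) 0.
    exists I => //; rewrite im0 scale0r addr0.
    by move/qabs_eq0 : im0; rewrite /qim => /eqP; rewrite subr_eq0 => /eqP.
  exists ((qabs (qim q))^-1 *: qim q).
    split; last by rewrite qabsZ ger0_norm ?invr_ge0// mulVf.
    by rewrite /qre !qcoordE //=; ring.
  by rewrite scalerA mulfV // scale1r /qim addrC subrK.
exists (qre q), (qabs (qim q)), J; split => //.
  by split; [exists (qre q), (qabs (qim q))|apply: le_r; rewrite ger0_norm].
rewrite -scaleNr; split; first by exists (qre q), (- qabs (qim q)).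
by apply: le_r; rewrite normrN ger0_norm.
Qed.

End QuaternionModulus.

(** * The operator L_q - R_p, its iterates and their formal derivatives *)

Section LeftRightOperator.
Variable A : nzRingType.
Implicit Types p q h e : A.

Definition lrop q p h : A := q * h - h * p.

Lemma lropD q p : {morph lrop q p : h k / h + k}.
Proof. by move=> h k; rewrite /lrop mulrDr mulrDl opprD addrACA. Qed.

Lemma lrop0 q p : lrop q p 0 = 0.
Proof. by rewrite /lrop mulr0 mul0r subr0. Qed.

Lemma lropMn q p h n : lrop q p (h *+ n) = lrop q p h *+ n.
Proof. by rewrite /lrop mulrnAr mulrnAl mulrnBl. Qed.

Lemma lropN q p h : lrop q p (- h) = - lrop q p h.
Proof. by rewrite /lrop mulrN mulNr opprB opprK addrC. Qed.

Lemma lropB q p h k : lrop q p (h - k) = lrop q p h - lrop q p k.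
Proof. by rewrite lropD lropN. Qed.

Lemma lrop_sum q p I r (P : pred I) (F : I -> A) :
  lrop q p (\sum_(i <- r | P i) F i) = \sum_(i <- r | P i) lrop q p (F i).
Proof. exact: (big_morph _ (lropD q p) (lrop0 q p)). Qed.

(** Left multiplication by q' commutes with R_p by associativity, and with L_q because q and q'
    commute. *)
Lemma iter_lrop_mul q q' p n h : GRing.comm q q' ->
  iter n (lrop q p) (q' * h) = q' * iter n (lrop q p) h.
Proof.
move=> qq'; elim: n => [//|n /= ->].
by rewrite /lrop mulrBr !mulrA qq'.
Qed.

Lemma iter_lropC q q' p m n h : GRing.comm q q' ->
  iter m (lrop q p) (iter n (lrop q' p) h)
  = iter n (lrop q' p) (iter m (lrop q p) h).
Proof.
move=> qq'; have step k : lrop q p (lrop q' p k) = lrop q' p (lrop q p k).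
  rewrite /lrop !mulrBr !mulrBl !mulrA qq' !opprB.
  by rewrite addrACA [RHS]addrACA [- (q * k * p) - _]addrC.
have swap k l :
    lrop q p (iter k (lrop q' p) l) = iter k (lrop q' p) (lrop q p l).
  by elim: k => //= k <-.
by elim: m => //= m ->.
Qed.

(** This is the binomial theorem for the commuting operators L_q and R_{-p}, proved by Pascal's
    rule. *)
Lemma iter_lropE q p m h : iter m (lrop q p) h =
  \sum_(0 <= i < m.+1) q ^+ i * h * (- p) ^+ (m - i) *+ 'C(m, i).
Proof.
elim: m => [|m IHm].
  by rewrite big_nat1 /= mul1r mulr1.
rewrite iterS {}IHm lrop_sum /lrop.
under eq_bigr => i _ do
  rewrite -mulrN mulrnAr mulrnAl !mulrA -exprS -[_ * - p]mulrA -exprSr.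
rewrite big_split /= [X in _ + X = _]big_nat_recl //= [RHS]big_nat_recl //=.
rewrite addrCA !bin0 !subn0; congr (_ + _).
(* The added term i = m vanishes because C(m, m+1) = 0; both sums now have the same range and
   Pascal's rule applies termwise. *)
have -> : \sum_(0 <= i < m)
      q ^+ i.+1 * h * (- p) ^+ (m - i.+1).+1 *+ 'C(m, i.+1) =
    \sum_(0 <= i < m.+1) q ^+ i.+1 * h * (- p) ^+ (m - i) *+ 'C(m, i.+1).
  rewrite [RHS]big_nat_recr //= bin_small // mulr0n addr0.
  by apply: eq_big_nat => i /andP[_ im]; rewrite -subSn // subSS.
rewrite -big_split; apply: eq_bigr => i _ /=.
by rewrite binS subSS mulrnDr addrC.
Qed.

(** The derivative of T^n 1 along e, by the product rule for T (T^m 1): T itself has derivative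
    L_e. *)
Fixpoint dpow q p e n : A :=
  if n is m.+1 then e * iter m (lrop q p) 1 + lrop q p (dpow q p e m) else 0.

(** The second derivative of T^n 1 along e. Differentiating either summand of [dpow] produces one
    copy of e times [dpow], hence the factor 2. *)
Fixpoint ddpow q p e n : A :=
  if n is m.+1 then (e * dpow q p e m) *+ 2 + lrop q p (ddpow q p e m) else 0.

Lemma dpowE q p e n : dpow q p e n.+1 =
  \sum_(j < n.+1) iter j (lrop q p) (e * iter (n - j) (lrop q p) 1).
Proof.
elim: n => [|n IHn]; first by rewrite big_ord1 /= lrop0 addr0.
rewrite [LHS]/= -/(dpow q p e n.+1) IHn lrop_sum [RHS]big_ord_recl.
by congr (_ + _).
Qed.

End LeftRightOperator.

(** * Star products as iterates, and summation over the quaternion basis *)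

Section StarProducts.
Variable R : realType.
Implicit Types p q h e x : quat R.

Lemma star_pow_iter m q p : star_pow m q p = iter m (lrop q p) 1.
Proof.
by rewrite iter_lropE /star_pow; under [RHS]eq_bigr do rewrite mulr1.
Qed.

Lemma star_pow_mul_iter m k q p : star_pow_mul m k q p =
  iter m (lrop q p) (iter k (lrop (qconj q) p) 1).
Proof.
rewrite !iter_lropE; apply: eq_bigr => i _.
rewrite mulr_sumr mulr_suml -sumrMnl; apply: eq_bigr => j _.
by rewrite mulr1 mulrnAr mulrnAl -mulrnA mulnC -!mulrA -exprD addnC.
Qed.

Lemma qconjM p q : qconj (p * q) = qconj q * qconj p.
Proof. by apply: quatP; rewrite !qcoordE //=; ring. Qed.

Lemma qconj1 : qconj (1 : quat R) = 1.
Proof. by apply: quatP; rewrite !qcoordE //=; ring. Qed.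

Lemma qconj_comm q : GRing.comm q (qconj q).
Proof. by apply: quatP; rewrite !qcoordE //=; ring. Qed.

Lemma sum_basis_sandwich x :
  \sum_(i < 4) qbasis R i * x * qbasis R i = - qconj x *+ 2.
Proof.
have inord_eq i j : (i < 4)%N -> (j < 4)%N ->
    (inord i == inord j :> 'I_4) = (i == j).
  by move=> i4 j4; rewrite -val_eqE /= !inordK.
rewrite big_ord4 mulr2n.
apply: quatP; rewrite !qcoordE //= !inord_eq //=; ring.
Qed.

(** The inserted factor x makes the induction on a work: the q released by one application of T is
    absorbed as x * q, whose conjugate puts [qconj q] on the left, as S requires. *)
Lemma sum_basis_iter q p a x h :
  \sum_(i < 4) qbasis R i * x * iter a (lrop q p) (qbasis R i * h) =
  - iter a (lrop (qconj q) p) (qconj x * h) *+ 2.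
Proof.
elim: a x => [|a IHa] x /=.
  under eq_bigr do rewrite mulrA.
  by rewrite -mulr_suml sum_basis_sandwich mulrnAl mulNr.
under eq_bigr do rewrite /lrop mulrBr !mulrA -[_ * x * q]mulrA.
rewrite big_split /= sumrN -mulr_suml !IHa qconjM -mulrA iter_lrop_mul //.
by rewrite /lrop opprB mulrnAl mulNr mulrnBl addrC mulNrn opprK mulNrn.
Qed.

Lemma sum_basis_dpow q p n :
  \sum_(i < 4) qbasis R i * dpow q p (qbasis R i) n.+1 =
  - (\sum_(j < n.+1)
      iter (n - j) (lrop q p) (iter j (lrop (qconj q) p) 1)) *+ 2.
Proof.
under eq_bigr do rewrite dpowE mulr_sumr.
rewrite exchange_big -sumrN -sumrMnl; apply: eq_bigr => j _ /=.
under eq_bigr do rewrite -[X in X * _]mulr1.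
rewrite sum_basis_iter qconj1 mul1r iter_lropC //; exact/esym/qconj_comm.
Qed.

(** In the recursion for [ddpow], the outer T raises each power of T by one, and the [dpow] summand
    adds one more copy of each T^(n-j) S^j 1. This produces the multiplicity n - j + 1. *)
Lemma sum_basis_ddpow q p n :
  \sum_(i < 4) ddpow q p (qbasis R i) n.+2 =
  - (\sum_(j < n.+1) iter (n - j) (lrop q p)
      (iter j (lrop (qconj q) p) 1) *+ (n - j).+1) *+ 4.
Proof.
elim: n => [|n IHn].
  rewrite [LHS](_ : _ =
    (\sum_(i < 4) qbasis R i * dpow q p (qbasis R i) 1) *+ 2).
    by rewrite sum_basis_dpow !big_ord1 -mulrnA.
  rewrite -sumrMnl; apply: eq_bigr => i _ /=.
  by rewrite !mulr0 mul0rn !lrop0 !addr0 lrop0 addr0.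
transitivity ((\sum_(i < 4) qbasis R i * dpow q p (qbasis R i) n.+2) *+ 2
    + lrop q p (\sum_(i < 4) ddpow q p (qbasis R i) n.+2)).
  by rewrite -sumrMnl lrop_sum -big_split.
rewrite IHn sum_basis_dpow lropMn lropN.
rewrite -mulrnA -mulrnDl -opprD; congr (- _ *+ 4).
(* The last index, j = n + 1, occurs only in the [dpow] sum, so it is split off with multiplicity
   1. *)
rewrite lrop_sum [X in X + _]big_ord_recr [RHS]big_ord_recr /= !subnn mulr1n.
rewrite addrAC; congr (_ + _).
rewrite -big_split; apply: eq_bigr => j _ /=.
have -> : (n.+1 - j = (n - j).+1)%N by rewrite subSn // -ltnS ltn_ord.
by rewrite lropMn iterS -mulrS.
Qed.

Lemma Qtilde_sum_ddpow n q p (c : quat R) :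
  Qtilde n q p * (- 2%:R * n.+2%:R * n.+1%:R * c) =
  (\sum_(i < 4) ddpow q p (qbasis R i) n.+2) * c.
Proof.
rewrite sum_basis_ddpow /Qtilde big_mkord.
(* The integer factor of b_n is a real scalar; multiplied by the coefficient 2 (n-j+1) /
   ((n+1)(n+2)) of [Qtilde] it leaves -4 (n-j+1). *)
have -> : - 2%:R * n.+2%:R * n.+1%:R * c = (- (2 * n.+2 * n.+1)%:R : R) *: c.
  by rewrite scaleNr scaler_nat !mulNr -!natrM mulr_natl.
rewrite -scalerAr; have -> : (2 : quat R) = (2%:R : R) *: 1.
  by rewrite scaler_nat.
rewrite -!scalerAl mul1r scalerA scalerAl; congr (_ * c).
rewrite -[RHS]scaler_nat scalerN -scaleNr !scaler_sumr; apply: eq_bigr => j _.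
rewrite scalerA star_pow_mul_iter -[X in _ = _ *: X]scaler_nat scalerA.
congr (_ *: _); rewrite !natrM.
have := pnatr_eq0 R n.+1; have := pnatr_eq0 R n.+2.
move: (n.+1%:R) (n.+2%:R) => a b /= b0 a0; field.
by rewrite a0 b0.
Qed.

End StarProducts.

(** * Termwise differentiation and the root test *)

Section TermwiseDerivative.
Variables (R : realType) (V W : normedModType R).

(** Summing the remainder bounds gives a remainder of at most t^2 times the sum of c for the whole
    series, which is o(t). *)
Lemma is_derive_series (g : nat -> V -> W) (G : V -> W) (x v : V)
    (dg : nat -> W) (L : W) (c : nat -> R) (d : R) :
    0 < d -> cvgn (series c) -> series dg @ \oo --> L ->
    (forall t, `|t| < d ->
      series (fun n => g n (t *: v + x)) @ \oo --> G (t *: v + x)) ->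
    (forall t n, `|t| < d ->
      `|g n (t *: v + x) - g n x - t *: dg n| <= t ^+ 2 * c n) ->
  is_derive x v G L.
Proof.
move=> d0 cc dgL gG rem; set S := limn (series c).
have Gx : series (g ^~ x) @ \oo --> G x.
  by have := gG 0; rewrite normr0 => /(_ d0); rewrite scale0r add0r.
have remG t : `|t| < d ->
    `|G (t *: v + x) - G x - t *: L| <= t ^+ 2 * S.
  move=> td; pose r n := g n (t *: v + x) - g n x - t *: dg n.
  have r_lim : series r @ \oo --> G (t *: v + x) - G x - t *: L.
    have -> : series r = series (fun n => g n (t *: v + x))
        - series (g ^~ x) - t \*: series dg.
      apply/funext => n; rewrite !fctE /series /= scaler_sumr.
      by rewrite -!sumrN -!big_split.
    by apply: cvgB; [apply: cvgB => //; exact: gG|exact: cvgZl_tmp].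
  apply: ler_cvg_to (cvg_norm r_lim) (cvgM (cvg_cst (t ^+ 2)) cc) _.
  apply: nearW => n; rewrite /series /= (le_trans (ler_norm_sum _ _ _)) //.
  by rewrite mulr_sumr ler_sum // => i _; exact: rem.
have lim : (fun h => h^-1 *: ((G \o shift x) (h *: v) - G x)) @ 0^' --> L.
  apply/cvgrPdist_le => eps eps0; near=> h.
  have h0 : h != 0 by near: h; exact: nbhs_dnbhs_neq.
  rewrite -normrN opprB -[L](scalerK h0) -scalerBr normrZ normfV.
  rewrite ler_pdivrMl ?normr_gt0 // (le_trans (remG h _)) //.
    by near: h; exact: dnbhs0_lt.
  rewrite -real_normK ?num_real // expr2 -mulrA ler_wpM2l //.
  rewrite (le_trans (ler_norm _)) // normrM normr_id.
  (* The 1 keeps the divisor positive when the sum of c is 0. *)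
  rewrite (@le_trans _ _ (`|h| * (`|S| + 1))) // ?ler_wpM2l ?lerDl //.
  rewrite -ler_pdivlMr ?ltr_wpDl //.
  by near: h; apply: dnbhs0_le; rewrite divr_gt0 // ltr_wpDl.
by apply: DeriveDef; [apply/cvg_ex; exists L|exact: cvg_lim].
Unshelve. all: by end_near. Qed.

End TermwiseDerivative.

(** For sg strictly between B and rho, u n is eventually at most sg^(-n), so the series is dominated
    by a geometric one of ratio B / sg. *)
Lemma root_test_cvg (R : realType) (u : nat -> R) (rho : \bar R) (B : R) :
  (forall n, 0 <= u n) -> 0 <= B -> (B%:E < rho)%E ->
  (rho^-1 = limn_esup (fun n => (u n `^ n%:R^-1)%R%:E))%E ->
  cvgn (series (fun n => u n * B ^+ n)).
Proof.
move=> u0 B0 Brho rhoE.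
have [sg [Bsg sgrho]] : exists sg : R, B < sg /\ (rho^-1 < sg^-1%:E)%E.
  case: rho Brho {rhoE} => [r|_|] //.
    rewrite lte_fin => Br; exists ((B + r) / 2).
    split; first by rewrite midf_lt.
    have r0 : 0 < r by exact: le_lt_trans Br.
    rewrite inver gt_eqF // lte_fin ltf_pV2 ?posrE ?midf_lt //.
    by rewrite divr_gt0 // ltr_wpDl.
  exists (B + 1); split; first by rewrite ltrDl.
  by rewrite invey lte_fin invr_gt0 ltr_wpDl.
have sg0 : 0 < sg by exact: le_lt_trans Bsg.
move: sgrho; rewrite rhoE limn_esup_lim (cvg_lim _ (@cvg_esups_inf _ _)) //.
move=> /ereal_inf_lt [_ [N _ <-] supN].
have uN n : (N <= n)%N -> (0 < n)%N -> u n <= sg^-1 ^+ n.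
  move=> Nn n0.
  have : ((u n `^ n%:R^-1)%:E <= sg^-1%:E)%E.
    by apply: le_trans (ltW supN); apply: ereal_sup_ubound; exists n.
  rewrite lee_fin => le_sg.
  have -> : u n = (u n `^ n%:R^-1) ^+ n.
    rewrite -powR_mulrn ?powR_ge0 // -powRrM mulVf ?pnatr_eq0 -?lt0n //.
    by rewrite powRr1.
  by rewrite lerXn2r // nnegrE ?powR_ge0 // invr_ge0 ltW.
(* The root bound holds only for n >= N and n > 0: at n = 0 the exponent is 0 and says nothing about
   u 0. The terms up to N are therefore replaced by 0. *)
pose w n := if (n < N.+1)%N then 0 else u n * B ^+ n.
rewrite -(is_cvg_series_restrict N.+1).
have -> : (fun n => \sum_(N.+1 <= k < n) u k * B ^+ k) =
    (fun n => \sum_(N.+1 <= k < n) w k).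
  apply/funext => n; apply: eq_big_nat => k /andP[Nk _].
  by rewrite /w ltnS leqNgt Nk.
rewrite (is_cvg_series_restrict N.+1).
have Bsg0 : 0 <= B / sg by rewrite divr_ge0 // ltW.
apply: (@series_le_cvg _ _ (geometric 1 (B / sg))).
- by move=> n; rewrite /w; case: ifP => // _; rewrite mulr_ge0 ?exprn_ge0.
- by move=> n; rewrite /= mul1r exprn_ge0.
- move=> n; rewrite /w /= mul1r; case: ifPn => [_|].
    by rewrite exprn_ge0.
  rewrite -leqNgt => Nn; rewrite exprMn mulrC ler_wpM2l ?exprn_ge0 //.
  by rewrite uN ?(ltnW Nn) ?(leq_ltn_trans _ Nn).
- by apply: is_cvg_geometric_series; rewrite ger0_norm // ltr_pdivrMr ?mul1r.
Qed.

(** * Geometric bounds for the iterates, their increments and Taylor remainders *)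

Section Growth.
Variables (R : realType) (p : quat R).
Implicit Types (q e : quat R) (s eta t : R).

(** T has norm at most s, and s (K / eta) + K = (K / eta)(s + eta). A forcing term of size K (s +
    eta)^n thus costs a factor 1 / eta but leaves the ratio unchanged, so the lemma can be applied
    repeatedly. *)
Lemma lrop_growth q e s eta K (u v : nat -> quat R) :
    qradius p q <= s -> 0 < eta -> 0 <= K -> qabs e <= 1 ->
    qabs (u 0) <= K / eta ->
    (forall n, u n.+1 = lrop q p (u n) + e * v n) ->
    (forall n, qabs (v n) <= K * (s + eta) ^+ n) ->
  forall n, qabs (u n) <= K / eta * (s + eta) ^+ n.
Proof.
move=> qs eta0 K0 e1 u0 uS vK; elim=> [|n IHn]; first by rewrite mulr1.
have s0 : 0 <= s by apply: le_trans qs; exact: qabs_ge0.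
have -> : K / eta * (s + eta) ^+ n.+1 =
    s * (K / eta * (s + eta) ^+ n) + 1 * (K * (s + eta) ^+ n).
  by rewrite exprS; field; rewrite gt_eqF.
rewrite uS (le_trans (qabsD _ _)) // lerD //.
  rewrite (le_trans (qabs_comm_le _ _ _)) //.
  by rewrite ler_pM ?qabs_ge0.
by rewrite qabsM ler_pM ?qabs_ge0.
Qed.

Lemma lrop_shift q e t h :
  lrop (t *: e + q) p h = lrop q p h + e * (t *: h).
Proof. by rewrite /lrop mulrDl -scalerAl -scalerAr -addrA addrC. Qed.

Lemma lropZ q t h : lrop q p (t *: h) = t *: lrop q p h.
Proof. by rewrite /lrop -scalerAl -scalerAr scalerBr. Qed.

Variables (q e : quat R) (s eta t : R).
Hypotheses (qs : qradius p q <= s) (eta0 : 0 < eta) (e1 : qabs e <= 1).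
Hypothesis qts : qradius p (t *: e + q) <= s.

Local Notation B := (s + eta).
Local Notation P := (fun n x => iter n (lrop x p) 1).

Let s0 : 0 <= s. Proof. by apply: le_trans qs; exact: qabs_ge0. Qed.
Let B0 : 0 <= B. Proof. by rewrite addr_ge0 // ltW. Qed.
Let eta_neq0 : eta != 0. Proof. by rewrite gt_eqF. Qed.
Let eta_inv0 : 0 <= eta^-1. Proof. by rewrite invr_ge0 ltW. Qed.
Let K0 (K : R) : 0 <= K -> 0 <= K / eta.
Proof. by move=> K0; rewrite mulr_ge0. Qed.

Lemma qabs_iter_le x n : qradius p x <= s -> qabs (P n x) <= B ^+ n.
Proof.
(* There is no forcing here, and K = eta makes the constant K / eta equal to 1. *)
move=> xs; rewrite -[leRHS]mul1r -(divff eta_neq0).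
apply: (@lrop_growth x 0 _ _ _ (P ^~ x) (fun=> 0)) => //.
- exact: ltW.
- by rewrite qabs0.
- by rewrite qabs1 divff.
- by move=> m; rewrite mul0r addr0.
- by move=> m; rewrite qabs0 mulr_ge0 ?exprn_ge0 // ltW.
Qed.

Lemma qabs_dpow_le x n : qradius p x <= s ->
  qabs (dpow x p e n) <= 1 / eta * B ^+ n.
Proof.
move=> xs; apply: (@lrop_growth x e _ _ _ (dpow x p e) (P ^~ x)) => //.
- by rewrite qabs0 K0.
- by move=> m; rewrite addrC.
- by move=> m; rewrite mul1r qabs_iter_le.
Qed.

Lemma qabs_ddpow_le n : qabs (ddpow q p e n) <= 2 * (1 / eta) / eta * B ^+ n.
Proof.
apply: (@lrop_growth q e _ _ _ (ddpow q p e)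
  (fun n => dpow q p e n *+ 2)) => //.
- by rewrite mulr_ge0 // K0.
- by rewrite qabs0 K0 // mulr_ge0 // K0.
- by move=> m; rewrite /= addrC mulrnAr.
- move=> m; rewrite -scaler_nat qabsZ normr_nat -mulrA.
  by rewrite ler_wpM2l // qabs_dpow_le.
Qed.

Lemma qabs_iter_incr n :
  qabs (P n (t *: e + q) - P n q) <= `|t| / eta * B ^+ n.
Proof.
apply: (@lrop_growth q e _ _ _ (fun n => P n (t *: e + q) - P n q)
  (fun n => t *: P n (t *: e + q))) => //.
- by rewrite subrr qabs0 K0.
- by move=> m; rewrite !iterS lrop_shift lropB addrAC.
- by move=> m; rewrite qabsZ ler_wpM2l // qabs_iter_le.
Qed.

(** The remainder obeys the recursion of T with forcing t times the increment bounded in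
    [qabs_iter_incr]; this gives the second factor t. *)
Lemma qabs_iter_rem n :
  qabs (P n (t *: e + q) - P n q - t *: dpow q p e n)
  <= `|t| * (`|t| / eta) / eta * B ^+ n.
Proof.
apply: (@lrop_growth q e _ _ _
  (fun n => P n (t *: e + q) - P n q - t *: dpow q p e n)
  (fun n => t *: (P n (t *: e + q) - P n q))) => //.
- by rewrite mulr_ge0 // K0.
- by rewrite scaler0 subr0 subrr qabs0 K0 // mulr_ge0 // K0.
- move=> m; rewrite !iterS lrop_shift !lropB /= lropZ.
  rewrite !(scalerDr, scalerN, mulrDr, mulrN).
  have regroup (x y z c d : quat R) : x + y - z - (c + d) = x - z - d + (y - c).
    by apply: quatP; rewrite !qcoordE; ring.
  by rewrite -!scalerAr regroup.
- by move=> m; rewrite qabsZ -mulrA ler_wpM2l // qabs_iter_incr.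
Qed.

Lemma qabs_dpow_incr n :
  qabs (dpow (t *: e + q) p e n - dpow q p e n)
  <= 2 * (`|t| / eta) / eta * B ^+ n.
Proof.
apply: (@lrop_growth q e _ _ _
  (fun n => dpow (t *: e + q) p e n - dpow q p e n)
  (fun n => P n (t *: e + q) - P n q + t *: dpow (t *: e + q) p e n)) => //.
- by rewrite mulr_ge0 // K0.
- by rewrite subrr qabs0 K0 // mulr_ge0 // K0.
- move=> m; rewrite /= lrop_shift lropB mulrDr mulrBr.
  have regroup (x y z c d : quat R) :
      x + (y + z) - (c + d) = y - d + (x - c + z).
    by apply: quatP; rewrite !qcoordE; ring.
  exact: regroup.
- move=> m; rewrite (le_trans (qabsD _ _)) // mulr2n !mulrDl mul1r lerD //.
    exact: qabs_iter_incr.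
  by rewrite qabsZ -mulrA ler_wpM2l // -[X in X * _]mul1r qabs_dpow_le.
Qed.

(** The forcing is the remainder of the iterates plus t times the increment of [dpow]; the constant
    amounts to 3 t^2 / eta^3. *)
Lemma qabs_dpow_rem n :
  qabs (dpow (t *: e + q) p e n - dpow q p e n - t *: ddpow q p e n)
  <= (`|t| * (`|t| / eta) / eta + `|t| * (2 * (`|t| / eta) / eta)) / eta
     * B ^+ n.
Proof.
apply: (@lrop_growth q e _ _ _
  (fun n => dpow (t *: e + q) p e n - dpow q p e n - t *: ddpow q p e n)
  (fun n => P n (t *: e + q) - P n q - t *: dpow q p e n
  + t *: (dpow (t *: e + q) p e n - dpow q p e n))) => //.
- by rewrite addr_ge0 // !mulr_ge0.
- by rewrite /= scaler0 !subrr qabs0 K0 // addr_ge0 // !mulr_ge0.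
- move=> m; rewrite /= lrop_shift !lropB lropZ.
  rewrite !(mulrDr, mulrN, scalerDr, scalerN) -!scalerAr.
  have regroup (x y z c d g w : quat R) : x + (y + z) - (c + d) - (w + w + g)
      = y - d - g + (x - c - w + (z - w)).
    by apply: quatP; rewrite !qcoordE; ring.
  exact: regroup.
- move=> m; rewrite (le_trans (qabsD _ _)) // mulrDl lerD //.
    exact: qabs_iter_rem.
  by rewrite qabsZ -[leRHS]mulrA ler_wpM2l // qabs_dpow_incr.
Qed.

End Growth.

(** * Differentiating the star series twice and summing the Laplacian *)

Section StarSeries.
Variables (R : realType) (p : quat R) (rho : \bar R) (a : nat -> quat R).
Variable f : quat R -> quat R.

Let disc (q : quat R) := ((qradius p q)%:E < rho)%E.

Hypothesis a_cvg : forall B : R, 0 <= B -> (B%:E < rho)%E ->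
  cvgn (series (fun n => qabs (a n) * B ^+ n)).
Hypothesis f_sum : forall q, disc q ->
  series (fun n => star_pow n q p * a n) @ \oo --> f q.

(** Two margins eta are needed: one for moving q to q + t e with |t| < eta, one for the loss from s
    to s + eta in [lrop_growth]. A third of the gap to rho leaves room for both. *)
Lemma disc_margin q : disc q ->
  exists s eta : R,
    [/\ 0 < eta, qradius p q + eta = s & ((s + eta)%:E < rho)%E].
Proof.
rewrite /disc; case: rho => [r|_|] //.
  rewrite lte_fin => qr; exists (qradius p q + (r - qradius p q) / 3).
  exists ((r - qradius p q) / 3); split => //.
    by rewrite divr_gt0 ?subr_gt0.
  by rewrite lte_fin; lra.
by exists (qradius p q + 1), 1; rewrite ltr01 ltry.
Qed.

Lemma disc_near q : disc q -> \forall x \near q, disc x.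
Proof.
move=> /disc_margin[s [eta [eta0 <- lt_rho]]].
near=> x; rewrite /disc (le_lt_trans _ lt_rho) // lee_fin.
rewrite (le_trans (qradius_lip p q x)) // -addrA lerD2l.
(* The doubled margin absorbs the factor 2 between modulus and sup norm. *)
rewrite (le_trans (qabs_le_norm _)) // -[eta + eta]mulr2n -[eta *+ 2]mulr_natl.
rewrite ler_wpM2l //.
Unshelve. all: by end_near. Qed.

Let a_cvgZ (K B : R) : 0 <= B -> (B%:E < rho)%E ->
  cvgn (series (fun n => K * (qabs (a n) * B ^+ n))).
Proof.
by move=> B0 Brho; have := @is_cvg_seriesZ _ _ K (a_cvg B0 Brho).
Qed.

Lemma cvg_series_le (B K : R) (w : nat -> quat R) : 0 <= B -> (B%:E < rho)%E ->
  (forall n, qabs (w n) <= K * B ^+ n) -> cvgn (series (fun n => w n * a n)).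
Proof.
move=> B0 Brho wK; apply: normed_cvg.
apply: (@series_le_cvg _ _ (fun n => K * (qabs (a n) * B ^+ n))).
- by move=> n; exact: normr_ge0.
- move=> n; rewrite /= mulrCA mulr_ge0 ?qabs_ge0 //.
  by rewrite (le_trans _ (wK n)) ?qabs_ge0.
- move=> n; rewrite (le_trans (norm_le_qabs _)) // qabsM /=.
  by rewrite [leRHS]mulrCA [leRHS]mulrC ler_wpM2r ?qabs_ge0.
- exact: a_cvgZ.
Qed.

Section Direction.
Variable e : quat R.
Hypothesis e1 : qabs e <= 1.

Let shift_radius q s eta t : qradius p q + eta = s -> `|t| < eta ->
  qradius p (t *: e + q) <= s.
Proof.
move=> <- teta; rewrite (le_trans (qradius_lip p q _)) // lerD2l addrK qabsZ.
by rewrite (le_trans _ (ltW teta)) // ler_piMr.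
Qed.

Lemma is_cvg_dpow q : disc q -> cvgn (series (fun n => dpow q p e n * a n)).
Proof.
move=> /disc_margin[s [eta [eta0 sE lt_rho]]].
have qs : qradius p q <= s by rewrite -sE lerDl ltW.
have B0 : 0 <= s + eta.
  by rewrite addr_ge0 ?(ltW eta0) // (le_trans _ qs) // qabs_ge0.
exact: cvg_series_le B0 lt_rho (fun n => qabs_dpow_le qs eta0 e1 n qs).
Qed.

Lemma is_cvg_ddpow q : disc q -> cvgn (series (fun n => ddpow q p e n * a n)).
Proof.
move=> /disc_margin[s [eta [eta0 sE lt_rho]]].
have qs : qradius p q <= s by rewrite -sE lerDl ltW.
have B0 : 0 <= s + eta.
  by rewrite addr_ge0 ?(ltW eta0) // (le_trans _ qs) // qabs_ge0.
exact: cvg_series_le B0 lt_rho (fun n => qabs_ddpow_le qs eta0 e1 n).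
Qed.

Lemma is_derive_star_series q : disc q ->
  is_derive q e f (limn (series (fun n => dpow q p e n * a n))).
Proof.
move=> Dq; have [s [eta [eta0 sE lt_rho]]] := disc_margin Dq.
have qs : qradius p q <= s by rewrite -sE lerDl ltW.
have B0 : 0 <= s + eta.
  by rewrite addr_ge0 ?(ltW eta0) // (le_trans _ qs) // qabs_ge0.
apply: (@is_derive_series _ _ _ (fun n q => star_pow n q p * a n) _ _ _ _ _
  (fun n => eta^-1 ^+ 2 * (qabs (a n) * (s + eta) ^+ n)) eta) => //.
- exact: a_cvgZ.
- exact: is_cvg_dpow.
- move=> t teta; apply: f_sum; rewrite /disc (le_lt_trans _ lt_rho) // lee_fin.
  by rewrite (le_trans (shift_radius sE teta)) // lerDl ltW.
- move=> t n teta; rewrite (scalerAl t _ (a n)) -!mulrBl.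
  rewrite (le_trans (norm_le_qabs _)) // qabsM !star_pow_iter.
  have := qabs_iter_rem qs eta0 e1 (shift_radius sE teta) n.
  move=> /(ler_wpM2r (qabs_ge0 (a n))) /le_trans; apply.
  rewrite -(real_normK (num_real t)) /=.
  by rewrite le_eqVlt; apply/orP; left; apply/eqP; ring.
Qed.

Lemma is_derive_derive_star_series q : disc q ->
  is_derive q e ('D_e f) (limn (series (fun n => ddpow q p e n * a n))).
Proof.
move=> Dq; have [s [eta [eta0 sE lt_rho]]] := disc_margin Dq.
have qs : qradius p q <= s by rewrite -sE lerDl ltW.
have B0 : 0 <= s + eta.
  by rewrite addr_ge0 ?(ltW eta0) // (le_trans _ qs) // qabs_ge0.
refine (@is_derive_series R (quat R) (quat R) (fun n q => dpow q p e n * a n)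
  _ _ _ (fun n => ddpow q p e n * a n) _
  (fun n => 3 * eta^-1 ^+ 3 * (qabs (a n) * (s + eta) ^+ n)) eta
  _ _ _ _ _) => //.
- exact: a_cvgZ.
- exact: is_cvg_ddpow.
- move=> t teta.
  (* ['D_e f] equals the series of [dpow] only inside the disc, so the shifted point must be placed
     there first. *)
  have Dt : disc (t *: e + q).
    rewrite /disc (le_lt_trans _ lt_rho) // lee_fin.
    by rewrite (le_trans (shift_radius sE teta)) // lerDl ltW.
  rewrite (@derive_val _ _ _ _ _ _ _ (is_derive_star_series Dt)).
  exact: is_cvg_dpow.
- move=> t n teta; rewrite (scalerAl t _ (a n)) -!mulrBl.
  rewrite (le_trans (norm_le_qabs _)) // qabsM.
  have := qabs_dpow_rem qs eta0 e1 (shift_radius sE teta) n.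
  move=> /(ler_wpM2r (qabs_ge0 (a n))) /le_trans; apply.
  rewrite -(real_normK (num_real t)) /=.
  by rewrite le_eqVlt; apply/orP; left; apply/eqP; ring.
Qed.

End Direction.

Lemma has_second_partials_star_series q : disc q -> has_second_partials f q.
Proof.
move=> Dq i; have e1 : qabs (qbasis R i) <= 1 by rewrite qabs_basis.
split; last by have [] := is_derive_derive_star_series e1 Dq.
apply: filterS (disc_near Dq) => x Dx.
by have [] := is_derive_star_series e1 Dx.
Qed.

Lemma laplacian_star_series q : disc q ->
  series (fun n => Qtilde n q p * (- 2%:R * n.+2%:R * n.+1%:R * a n.+2)) @ \oo
    --> laplacian f q.
Proof.
move=> Dq; have e1 i : qabs (qbasis R i) <= 1 by rewrite qabs_basis.
have -> : laplacian f q =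
    \sum_(i < 4) limn (series (fun n => ddpow q p (qbasis R i) n * a n)).
  apply: eq_bigr => i _.
  by have [] := is_derive_derive_star_series (e1 i) Dq.
pose w n := \sum_(i < 4) ddpow q p (qbasis R i) n * a n.
have w_lim : series w @ \oo --> \sum_(i < 4)
    limn (series (fun n => ddpow q p (qbasis R i) n * a n)).
  have -> : series w = (fun n => \sum_(i < 4)
      series (fun n => ddpow q p (qbasis R i) n * a n) n).
    by apply/funext => n; rewrite /series /= exchange_big.
  by apply: cvg_big => [|i _]; [exact: add_continuous|exact: is_cvg_ddpow].
have w0 : w 0 = 0 by rewrite /w big1 // => i _; rewrite mul0r.
have w1 : w 1 = 0.
  by rewrite /w big1 // => i _; rewrite /= mulr0 mul0rn lrop0 addr0 mul0r.
(* The terms of index 0 and 1 have zero second derivative; dropping them pairs [Qtilde n] with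
   a_{n+2}. *)
rewrite -(cvg_shiftn 2) in w_lim; apply: cvg_trans w_lim.
apply: near_eq_cvg; apply: nearW => n.
rewrite /series /= addn2 !big_nat_recl // w0 w1 !add0r.
by apply: eq_bigr => k _; rewrite Qtilde_sum_ddpow /w mulr_suml.
Qed.

End StarSeries.

Theorem theorem7p10 (R : realType) (U : set (quat R)) (f : quat R -> quat R)
    (p I : quat R) (rho : \bar R) (a : nat -> quat R)
    (U_open : open U) (U_axial : axially_symmetric U)
    (f_slice : slice_hyperholomorphic U f)
    (Up : U p)
    (I_sphere : qsphere I) (p_slice : slice_plane I p)
    (rho_gt0 : (0 < rho)%E)
    (rho_limsup :
      (rho^-1 = limn_esup (fun n : nat => (qabs (a n) `^ (n%:R^-1))%R%:E))%E)
    (Omega_neq0 : Omega I p rho !=set0)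
    (Omega_sub : Omega I p rho `<=` U)
    (f_abs : forall q, Omega I p rho q ->
      cvgn (series (fun n => qabs (star_pow n q p * a n))))
    (f_unif : forall K : set (quat R), compact K -> K `<=` Omega I p rho ->
      {uniform K,
        (fun N q => series (fun n => star_pow n q p * a n) N) @ \oo --> f}) :
  forall q, Omega I p rho q ->
    has_second_partials f q /\
    series (fun n => Qtilde n q p * (- 2%:R * n.+2%:R * n.+1%:R * a n.+2)) @ \oo
      --> laplacian f q.
Proof.
have a_cvg (B : R) : 0 <= B -> (B%:E < rho)%E ->
    cvgn (series (fun n => qabs (a n) * B ^+ n)).
  move=> B0 Brho.
  exact: root_test_cvg (fun n => qabs_ge0 (a n)) B0 Brho rho_limsup.
(* Pointwise convergence is uniform convergence on the compact set {q}. *)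
have f_sum q : ((qradius p q)%:E < rho)%E ->
    series (fun n => star_pow n q p * a n) @ \oo --> f q.
  move=> Dq; have := f_unif [set q] (@compact_set1 _ q).
  rewrite uniform_set1; apply => x ->.
  exact/(Omega_qradius _ _ I_sphere p_slice).
move=> q /(Omega_qradius _ _ I_sphere p_slice) Dq.
split; first exact: has_second_partials_star_series a_cvg f_sum _ Dq.
exact: laplacian_star_series a_cvg f_sum _ Dq.
Qed.
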